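(* For each fixed integer $n\ge 1$, $\mathcal{D}(L_n,r)=\Theta(1/r^{n-1})$ as $r\rightarrow\infty$ (through positive integers); that is, there are positive constants $c_1,c_2$ and an integer $R$, all depending only on $n$, such that $c_1/r^{n-1}\le \mathcal{D}(L_n,r)\le c_2/r^{n-1}$ for all integers $r\ge R$.
   Context: $L_n$ denotes the $n$-dimensional lattice graph: its vertex set is $\mathbb{Z}^n$, and $\{(x_1,\ldots,x_n),(y_1,\ldots,y_n)\}$ is an edge if and only if $\sum_{i=1}^n |x_i-y_i|=1$. For a connected undirected graph $G$ with graph distance $d$, put $B_r(v)=\{u\in V(G): d(u,v)\le r\}$. A code is a nonempty subset $C\subseteq V(G)$. A code $C$ is $r$-identifying if (1) $B_r(v)\cap C\neq\emptyset$ for all $v\in V(G)$, and (2) $B_r(u)\cap C\ne B_r(v)\cap C$ for all $u\neq v$ in $V(G)$. The density of a code $C$ in $L_n$ is $\limsup_{m\to\infty} |C\cap Q_m|/|Q_m|$, where $Q_m$ is the set of $(x_1,\ldots,x_n)\in\mathbb{Z}^n$ with $|x_i|\le m$ for all $i$. $\mathcal{D}(L_n,r)$ denotes the minimum possible density (the infimum over all $r$-identifying codes) of an $r$-identifying code for $L_n$. *)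

(* Defs.v *)
From mathcomp Require Import all_boot all_order all_algebra finmap.
From mathcomp Require Import zify.
From mathcomp Require Import all_classical all_reals all_analysis.

Set Implicit Arguments.
Unset Strict Implicit.
Unset Printing Implicit Defensive.

Import Order.TTheory GRing.Theory Num.Theory.

Local Open Scope classical_set_scope.
Local Open Scope ring_scope.

Record connGraph := ConnGraph {
  vertex :> choiceType;
  adj : rel vertex;
  adj_sym : symmetric adj;
  adj_irr : irreflexive adj;
  adj_conn : forall u v : vertex, exists p, path adj u p /\ last u p = v }.

Definition walk (G : connGraph) (u v : G) (k : nat) : Prop :=
  exists p : seq G, [/\ path (@adj G) u p, last u p = v & size p = k].

Lemma ex_walk (G : connGraph) (u v : G) : exists k, `[< walk u v k >].
Proof.
have [p [pP pv]] := adj_conn u v.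
by exists (size p); apply/asboolP; exists p.
Qed.

Definition gdist (G : connGraph) (u v : G) : nat := ex_minn (ex_walk u v).

Definition gball (G : connGraph) (r : nat) (v : G) : set G :=
  [set u | (gdist u v <= r)%N].

Definition identifying (G : connGraph) (r : nat) (C : set G) : Prop :=
  [/\ C !=set0,
      forall v : G, gball r v `&` C !=set0 &
      forall u v : G, u <> v -> gball r u `&` C <> gball r v `&` C].

Definition lattice_adj (n : nat) : rel {ffun 'I_n -> int} :=
  fun x y => \sum_(i < n) `|x i - y i| == 1.

Lemma lattice_adj_sym n : symmetric (@lattice_adj n).
Proof.
by move=> x y; rewrite /lattice_adj; under eq_bigr do rewrite distrC.
Qed.

Lemma lattice_adj_irr n : irreflexive (@lattice_adj n).
Proof.
by move=> x; rewrite /lattice_adj big1// => i _; rewrite subrr normr0.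
Qed.

Lemma lattice_adj_conn n (x y : {ffun 'I_n -> int}) :
  exists p, path (@lattice_adj n) x p /\ last x p = y.
Proof.
have [k] := ubnP (\sum_(i < n) `|x i - y i|)%N.
elim: k x => // k IH x; rewrite ltnS => xyk.
have [->|/eqP xy] := eqVneq x y; first by exists [::].
have [i xyi] : exists i, x i != y i.
  apply/existsP; apply: contra_notT xy => /existsPn xy.
  by apply/ffunP => i; apply/eqP; rewrite -[_ == _]negbK xy.
pose z := [ffun j => if j == i then x i + Num.sg (y i - x i) else x j].
have zi : z i = x i + Num.sg (y i - x i) by rewrite ffunE eqxx.
have zj j : j != i -> z j = x j by rewrite ffunE => /negPf ->.
have xz : lattice_adj x z.
  rewrite /lattice_adj (bigD1 i)//= big1 => [|j /zj ->].
    by rewrite addr0 zi opprD addrA subrr sub0r normrN normr_sg subr_eq0 (eq_sym (y i)) xyi.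
  by rewrite subrr normr0.
have [|p [pP pl]] := IH z; last by exists (z :: p); rewrite /= xz.
apply: leq_trans xyk; rewrite (bigD1 i)//= [ltnRHS](bigD1 i)//=.
under eq_bigr => j ji do rewrite zj//.
rewrite ltn_add2r zi.
by case: sgrP; lia.
Qed.

Definition lattice (n : nat) : connGraph :=
  ConnGraph (@lattice_adj_sym n) (@lattice_adj_irr n) (@lattice_adj_conn n).

Definition cube (n m : nat) : set (lattice n) :=
  [set x : {ffun 'I_n -> int} | forall i, `|x i| <= m%:Z].
Arguments cube : clear implicits.

(* [fset_set] is the empty set by default outside finite sets; this lemma rules
   that case out in [density]. *)
Lemma finite_cube n m : finite_set (cube n m).
Proof.
pose f (g : {ffun 'I_n -> 'I_(m + m).+1}) : lattice n :=
  [ffun i => (g i)%:Z - m%:Z] : {ffun 'I_n -> int}.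
apply: (@sub_finite_set _ _ (f @` setT)); last exact/finite_image/finite_finset.
move=> x xm; exists [ffun i => inord (absz (x i + m%:Z))] => //.
apply/ffunP => i; rewrite !ffunE inordK;
  have : `|x i : int| <= m%:Z := xm i; move: (x i : int) => a; lia.
Qed.

Definition density (R : realType) (n : nat) (C : set (lattice n)) : \bar R :=
  limn_esup (fun m =>
    (#|` fset_set (C `&` cube n m)|%:R / #|` fset_set (cube n m)|%:R)%:E).

(* In \bar R an infimum over no code at all would be +oo, not the default 0 of
   the real-valued [inf]. *)
Definition min_density (R : realType) (n r : nat) : \bar R :=
  ereal_inf [set density R C | C in @identifying (lattice n) r].

(* Main.v *)
(** A codeword separating [v] from [v + e_0] lies in the symmetric difference of
    two balls, which has at most [2 (2r+1)^(n-1)] points: once the coordinates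
    other than the first are fixed, the first one can take only two values.
    Hence a code has density at least a constant times [1 / r^(n-1)].
    Conversely, take the union of the axis-parallel lines of a grid of mesh
    [k = r %/ n]. A ball [B_r(u)] meets a nearby line of direction [i] in a
    nonempty segment whose midpoint has [i]-th coordinate [u i], so the trace of
    the ball on the code determines [u]. *)
Require Import Defs.
From mathcomp Require Import all_boot all_order all_algebra finmap zify.
From mathcomp Require Import all_classical all_reals all_analysis.
Set Implicit Arguments.
Unset Strict Implicit.
Unset Printing Implicit Defensive.
Import Order.TTheory GRing.Theory Num.Theory.
Local Open Scope ring_scope.

(** * Counting finite sets through parametrisations *)

Lemma card_fset_set_cover (T V : choiceType) (U : finType) (A : set V)
    (B : set T) (h : T -> U -> V) :
  finite_set A -> finite_set B ->
  (forall x, A x -> exists y t, B y /\ x = h y t) ->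
  (#|` fset_set A| <= #|` fset_set B| * #|U|)%N.
Proof.
move=> finA finB AB.
(* Repetitions in this list are harmless: only its length matters for an upper bound. *)
pose s := [seq h y t | y <- enum_fset (fset_set B), t <- enum U].
rewrite cardE -(size_allpairs h); apply: uniq_leq_size => [|x].
  exact: fset_uniq.
rewrite in_fset_set// inE => /AB[y [t [By ->]]].
by apply: allpairs_f; rewrite ?mem_enum// in_fset_set// inE.
Qed.

Lemma card_fset_set_image (V : choiceType) (U : finType) (A : set V) (h : U -> V) :
  (forall x, A x -> exists t, x = h t) -> (#|` fset_set A| <= #|U|)%N.
Proof.
move=> Ah; have finA : finite_set A.
  apply: (@sub_finite_set _ _ (h @` setT)%classic).
    by move=> x /Ah[t ->]; exists t.
  exact/finite_image/finite_finset.
rewrite -[leqRHS]mul1n -(cardfs1 tt) -fset_set1.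
apply: (card_fset_set_cover (h := fun=> h)) => // x /Ah[t ->].
by exists tt, t.
Qed.

Lemma card_fset_set_inj (V : choiceType) (U : finType) (A : set V) (h : U -> V) :
  finite_set A -> injective h -> (forall t, A (h t)) ->
  (#|U| <= #|` fset_set A|)%N.
Proof.
move=> finA injh Ah; rewrite cardE -(size_map h); apply: uniq_leq_size.
  by rewrite map_inj_uniq// enum_uniq.
by move=> _ /mapP[t _ ->]; rewrite in_fset_set// inE.
Qed.

(** * The graph distance of the lattice as the l1 distance *)

Definition l1dist n (x y : {ffun 'I_n -> int}) : nat := (\sum_i `|x i - y i|)%N.

Lemma l1dist_triangle n (x y z : {ffun 'I_n -> int}) :
  (l1dist x z <= l1dist x y + l1dist y z)%N.
Proof. by rewrite -big_split /=; apply: leq_sum => i _; lia. Qed.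

Lemma lattice_adjE n (x y : {ffun 'I_n -> int}) :
  lattice_adj x y = (l1dist x y == 1%N).
Proof.
rewrite /lattice_adj /l1dist -eqz_nat; congr (_ == _).
by rewrite (big_morph Posz PoszD erefl); apply: eq_bigr => i _; rewrite abszE.
Qed.

Lemma l1dist_path n (x : {ffun 'I_n -> int}) p :
  path (@lattice_adj n) x p -> (l1dist x (last x p) <= size p)%N.
Proof.
elim: p x => [|y p IH] x /=; first by rewrite /l1dist big1// => i _; lia.
rewrite lattice_adjE => /andP[/eqP xy /IH yp].
by rewrite (leq_trans (l1dist_triangle x y _))// xy add1n ltnS.
Qed.

(** One unit step towards [y] in a coordinate where [x] and [y] differ lowers the l1 distance by
    exactly one; induction on that distance builds the walk. *)
Lemma walk_l1dist n (x y : lattice n) : walk x y (l1dist x y).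
Proof.
have [k] : exists k, l1dist x y = k by exists (l1dist x y).
elim: k x => [|k IH] x xyk.
  exists [::]; rewrite xyk; split=> //=; apply/ffunP => i.
  by move/eqP: xyk; rewrite sum_nat_eq0 => /forallP/(_ i)/=; lia.
have [i xyi] : exists i, x i != y i :> int.
  apply/existsP; apply: contra_eqT xyk => /existsPn xy.
  by rewrite /l1dist big1// => i _; move: (xy i) => /negPn/eqP ->; rewrite subrr.
pose z : {ffun 'I_n -> int} :=
  [ffun j => if j == i then x i + Num.sg (y i - x i) else x j].
have zj j : j != i -> z j = x j by rewrite ffunE => /negPf ->.
have zi : z i = x i + Num.sg (y i - x i) by rewrite ffunE eqxx.
have zyk : l1dist z y = k.
  move: xyk; rewrite /l1dist (bigD1 i)//= [in X in _ -> X](bigD1 i)//=.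
  under [in X in _ -> X]eq_bigr => j ji do rewrite zj//.
  rewrite zi; move: (x i : int) (y i : int) xyi => a b ab.
  by set s := (\sum_(_ | _) _)%N; case: sgrP; lia.
have [p [zp zpy sp]] := IH z zyk.
exists (z :: p); split=> //=; last by rewrite sp zyk xyk.
rewrite zp andbT lattice_adjE /l1dist (bigD1 i)//= big1 => [|j /zj ->]; last by rewrite subrr.
by rewrite zi; move: (x i : int) (y i : int) xyi => a b; case: sgrP; lia.
Qed.

Lemma gdistE n (x y : lattice n) : gdist x y = l1dist x y.
Proof.
rewrite /gdist; case: ex_minnP => k /asboolP[p [xp <- <-]] mink.
apply/eqP; rewrite eqn_leq l1dist_path// andbT.
by apply/mink/asboolP; exact: walk_l1dist.
Qed.

(** * Cubes and limits superior *)

Lemma card_cube n m : #|` fset_set (cube n m)| = (m.*2.+1 ^ n)%N.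
Proof.
pose h (f : {ffun 'I_n -> 'I_m.*2.+1}) : lattice n :=
  [ffun i => (f i)%:Z - m%:Z] : {ffun 'I_n -> int}.
have cardU : #|{ffun 'I_n -> 'I_m.*2.+1}| = (m.*2.+1 ^ n)%N.
  by rewrite card_ffun !card_ord.
apply/eqP; rewrite eqn_leq -cardU; apply/andP; split.
  apply: (card_fset_set_image (h := h)) => x xm.
  exists [ffun i => inord (absz (x i + m%:Z))]; apply/ffunP => i.
  rewrite !ffunE inordK;
    have : `|x i : int| <= m%:Z := xm i; move: (x i : int) => a; lia.
apply: (@card_fset_set_inj _ _ _ h (finite_cube n m)).
  move=> f g /ffunP fg; apply/ffunP => i; apply: val_inj => /=.
  by have := fg i; rewrite !ffunE => /addIr[].
by move=> f i; rewrite ffunE; move: (ltn_ord (f i)); move: (nat_of_ord (f i)) => a; lia.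
Qed.

Lemma finite_code_cube n m (C : set (lattice n)) :
  finite_set (C `&` cube n m)%classic.
Proof. by apply: sub_finite_set (finite_cube n m) => x []. Qed.

Lemma limn_esup_ge_eventually (R : realType) (u : nat -> \bar R) l N :
  (forall m, (N <= m)%N -> (l <= u m)%E) -> (l <= limn_esup u)%E.
Proof.
move=> lu; apply: le_ereal_inf_tmp => _ [V [M _ MV] <-].
(* The upper limit is an infimum of suprema over neighbourhoods [V] of infinity; the index
   [maxn M N] lies in [V] and past [N]. *)
apply: (le_trans (lu (maxn M N) (leq_maxr _ _))); apply: ereal_sup_ubound.
by exists (maxn M N) => //; apply: MV; exact: leq_maxl.
Qed.

Lemma limn_esup_le_eventually (R : realType) (u : nat -> \bar R) l N :
  (forall m, (N <= m)%N -> (u m <= l)%E) -> (limn_esup u <= l)%E.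
Proof.
move=> ul; apply: (@le_trans _ _ (ereal_sup (u @` [set m | (N <= m)%N])%classic)).
  apply: ereal_inf_lbound; exists [set m | (N <= m)%N]%classic => //.
  by exists N.
by apply: ge_ereal_sup => _ [m Nm <-]; exact: ul.
Qed.

(** * Lower bound: recovering the points of a cube from nearby codewords *)

Lemma codeword_shift n r (C : set (lattice n.+1)) (v : lattice n.+1) :
  identifying r C ->
  exists c, [/\ C c, (\sum_(i < n) `|c (lift ord0 i) - v (lift ord0 i)| <= r)%N &
    let s := (\sum_(i < n) `|c (lift ord0 i) - v (lift ord0 i)|)%N in
    (v ord0 = c ord0 + (r%:Z - s%:Z) \/ v ord0 = c ord0 - (r.+1%:Z - s%:Z))%R].
Proof.
move=> [_ _ idC].
pose w : lattice n.+1 :=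
  [ffun i => v i + (i == ord0)%:Z] : {ffun 'I_n.+1 -> int}.
have vw : v <> w.
  by move=> /ffunP/(_ ord0); rewrite ffunE eqxx; move: (v ord0 : int) => a; lia.
have [c [Cc Bc]] : exists c, C c /\
    (gdist c v <= r)%N != (gdist c w <= r)%N.
  apply: contra_notP (idC v w vw) => /forallNP nC; apply/seteqP.
  by split=> c [Bc Cc]; split=> //; move: (nC c) Bc => /not_andP[//|/negP];
    rewrite negbK /gball/= => /eqP ->.
(* The two distances share the part [s] and differ by one in the first coordinate. Exactly one being
   at most [r] puts [c] on the boundary of a ball: at distance [r] from [v], or [r.+1] from [v] and
   [r] from [w]. *)
exists c; move: Bc; rewrite !gdistE /l1dist !big_ord_recl.
under [X in _ != (_ + X <= _)%N]eq_bigr => i _ do rewrite ffunE/= addr0.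
rewrite ffunE eqxx; set s := (\sum_(_ < _) _)%N => Bc.
split=> //; move: (v ord0 : int) (c ord0 : int) Bc => a b; first by lia.
move=> Bc /=; lia.
Qed.

(** Each point of the small cube is a codeword of the enlarged cube plus an offset: [r.*2.+1]
    choices in each of [n] coordinates, then two for the first coordinate. *)
Lemma identifying_card_cube n r m (C : set (lattice n.+1)) :
  identifying r C ->
  (m.*2.+1 ^ n.+1 <=
   #|` fset_set (C `&` cube n.+1 (m + r.+1))| * (2 * r.*2.+1 ^ n))%N.
Proof.
move=> idC; pose U := (bool * {ffun 'I_n -> 'I_r.*2.+1})%type.
pose h (c : lattice n.+1) (t : U) : lattice n.+1 :=
  [ffun i => if unlift ord0 i is Some j then c i + ((t.2 j)%:Z - r%:Z) else
    let s := (\sum_j `|((t.2 j)%:Z - r%:Z)%R|)%N in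
    c ord0 + (if t.1 then r%:Z - s%:Z else - (r.+1%:Z - s%:Z))]
  : {ffun 'I_n.+1 -> int}.
have -> : (2 * r.*2.+1 ^ n = #|{: U}|)%N.
  by rewrite card_prod card_bool card_ffun !card_ord.
rewrite -card_cube.
apply: (card_fset_set_cover (h := h)); [exact: finite_cube|exact: finite_code_cube|].
move=> v vm; have [c [Cc sr sv]] := codeword_shift v idC.
have cvr j : (`|c (lift ord0 j) - v (lift ord0 j)| <= r)%N.
  by apply: leq_trans sr; rewrite (bigD1 j)//= leq_addr.
(* By [cvr] the offsets lie between [-r] and [r], so after the shift by [r] the default value of
   [inord] never occurs. *)
pose f : {ffun 'I_n -> 'I_r.*2.+1} :=
  [ffun j => inord `|v (lift ord0 j) - c (lift ord0 j) + r%:Z|].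
have fE j : (f j)%:Z - r%:Z = v (lift ord0 j) - c (lift ord0 j).
  rewrite ffunE inordK; move: (cvr j);
    move: (c (lift ord0 j) : int) (v (lift ord0 j) : int) => a b; lia.
have sE : (\sum_(j < n) `|c (lift ord0 j) - v (lift ord0 j)| =
    \sum_j `|((f j)%:Z - r%:Z)%R|)%N.
  by apply: eq_bigr => j _; rewrite fE distnC.
have [b vE] : exists b : bool, v = h c (b, f).
  exists `[< v ord0 = c ord0 + (r%:Z - (\sum_j `|((f j)%:Z - r%:Z)%R|)%N%:Z) >].
  apply/ffunP => i; rewrite ffunE; case: unliftP => [j|] -> /=.
    by rewrite fE addrC subrK.
  by case: asboolP => // nv0; move: sv; rewrite sE => -[].
exists c, (b, f); split=> //; split=> // i.
have vi : `|v i : int| <= m%:Z := vm i.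
(* The first coordinates of [c] and [v] may differ by [r.+1], the others by at most [r]; hence the
   margin [r.+1] of the cube. *)
case: (unliftP ord0 i) vi => [j|] ->.
  by move: (cvr j); move: (c _ : int) (v _ : int) => x y; lia.
move: sv sr => /=; set s := (\sum_(_ < _) _)%N.
by move: (c _ : int) (v _ : int) => x y; lia.
Qed.

(** * Upper bound: the code made of grid lines *)

Definition grid_lines n k : set (lattice n) :=
  [set x : {ffun 'I_n -> int} | exists i, forall j, j != i -> (k%:Z %| x j)%Z]%classic.

Definition line_point n k (u : {ffun 'I_n -> int}) i (t : int) : lattice n :=
  [ffun j => if j == i then t else (u j %/ k%:Z)%Z * k%:Z] : {ffun 'I_n -> int}.

Lemma grid_lines_line_point n k (u : lattice n) i t :
  grid_lines k (line_point k u i t).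
Proof. by exists i => j /negPf ji; rewrite ffunE ji dvdz_mull. Qed.

(** The line is obtained by rounding [u] but distances are taken to any [v], since the balls around
    two centres are compared on one common line. *)
Lemma gdist_line_point n k (u v : lattice n) i t :
  gdist (line_point k u i t) v =
  (`|(t - v i)%R| + \sum_(j | j != i) `|((u j %/ k%:Z)%Z * k%:Z - v j)%R|)%N.
Proof.
rewrite gdistE /l1dist (bigD1 i)//= ffunE eqxx; congr addn.
by apply: eq_bigr => j /negPf ji; rewrite ffunE ji.
Qed.

(** Rounding down to a multiple of [k] moves each coordinate by less than [k]. *)
Lemma line_point_near n k r (u : lattice n) i : (0 < k)%N -> (n * k <= r)%N ->
  (\sum_(j | j != i) `|((u j %/ k%:Z)%Z * k%:Z - u j)%R| <= r)%N.
Proof.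
move=> k0 nkr; apply: leq_trans nkr.
have -> : (n * k = \sum_(j < n) k)%N by rewrite sum_nat_const card_ord.
rewrite big_mkcond; apply: leq_sum => j _; case: ifP => // _.
have k0' : k%:Z != 0 by lia.
have := modz_ge0 (u j) k0'; have := ltz_pmod (u j) (d := k%:Z).
have := divz_eq (u j) k%:Z.
by move: (_ %/ _)%Z (_ %% _)%Z => q s; move: (u j : int) => x; lia.
Qed.

Lemma identifying_grid_lines n k r : (0 < n)%N -> (0 < k)%N -> (n * k <= r)%N ->
  identifying r (@grid_lines n k).
Proof.
move=> n0 k0 nkr; have ball_meets (v : lattice n) :
    (gball r v `&` @grid_lines n k !=set0)%classic.
  exists (line_point k v (Ordinal n0) (v (Ordinal n0))).
  split; last exact: grid_lines_line_point.
  by rewrite /gball/= gdist_line_point subrr add0n line_point_near.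
split=> //.
  by have [x [_ ?]] := ball_meets ([ffun=> 0] : {ffun 'I_n -> int}); exists x.
move=> u v uv /seteqP[suv svu]; apply: uv; apply/ffunP => i.
pose s (w : lattice n) :=
  (\sum_(j | j != i) `|((u j %/ k%:Z)%Z * k%:Z - w j)%R|)%N.
(* On the line of direction [i] near [u], the ball around [w] cuts out the interval with centre
   [w i] and radius [r - s w]. *)
have same_trace t :
    (`|(t - u i)%R| + s u <= r)%N = (`|(t - v i)%R| + s v <= r)%N.
  have Lt := grid_lines_line_point k u i t.
  rewrite -!gdist_line_point.
  by apply/idP/idP => Bt; [have [] := suv _ (conj Bt Lt)|have [] := svu _ (conj Bt Lt)].
have : (s u <= r)%N by exact: line_point_near.
move: (s u) (s v) (u i : int) (v i : int) same_trace => {}s s' a b same_trace sr.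
(* The interval around [a] is nonempty by [sr]. Testing the endpoints of both intervals shows that
   they coincide, so their centres do. *)
have := same_trace (a + (r%:Z - s%:Z)); have := same_trace (a - (r%:Z - s%:Z)).
have := same_trace (b + (r%:Z - s'%:Z)); have := same_trace (b - (r%:Z - s'%:Z)).
lia.
Qed.

(** A point is given by the direction of its line, its position along it, and [n] multiples of [k]
    of absolute value at most [m]. Points on several lines are counted more than once. *)
Lemma card_grid_lines_cube n k m : (0 < k)%N ->
  (#|` fset_set (@grid_lines n.+1 k `&` cube n.+1 m)| <=
   n.+1 * (m.*2.+1 * (m %/ k).*2.+1 ^ n))%N.
Proof.
move=> k0; set q := (m %/ k)%N.
pose U := ('I_n.+1 * ('I_m.*2.+1 * {ffun 'I_n -> 'I_q.*2.+1}))%type.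
pose h (t : U) : lattice n.+1 :=
  [ffun i => if unlift t.1 i is Some j then ((t.2.2 j)%:Z - q%:Z) * k%:Z
             else t.2.1%:Z - m%:Z] : {ffun 'I_n.+1 -> int}.
have -> : (n.+1 * (m.*2.+1 * q.*2.+1 ^ n) = #|{: U}|)%N.
  by rewrite !card_prod card_ffun !card_ord.
apply: (card_fset_set_image (h := h)) => x [[i xk] xm].
exists (i, (inord `|x i + m%:Z|,
  [ffun j => inord `|((x (lift i j) %/ k%:Z)%Z + q%:Z)%R|])).
apply/ffunP => l; rewrite ffunE /=; case: unliftP => [j|] ->.
  rewrite ffunE.
  have /dvdzP[d xd] : (k%:Z %| x (lift i j))%Z by rewrite xk// eq_sym neq_lift.
  have := xm (lift i j); rewrite xd mulzK//; last by lia.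
  have mq : (m < q.+1 * k)%N by rewrite /q ltn_ceil.
  move=> dm; have dq : (`|d| <= q)%N.
    by rewrite -ltnS -(ltn_pmul2r k0); lia.
  by rewrite inordK; lia.
have := xm i; move: (x i : int) => a am.
by rewrite inordK; lia.
Qed.

(** * From counts in cubes to densities *)

Lemma density_ge (R : realType) n (C : set (lattice n.+1)) (D N : nat) :
  (0 < D)%N ->
  (forall m, (N <= m)%N ->
    #|` fset_set (cube n.+1 m)| <= #|` fset_set (C `&` cube n.+1 m)| * D)%N ->
  (D%:R^-1%:E <= density R C)%E.
Proof.
move=> D0 le_cube; apply: (@limn_esup_ge_eventually _ _ _ N) => m /le_cube.
rewrite lee_fin card_cube => le_card.
rewrite ler_pdivlMr ?ltr0n ?expn_gt0// mulrC ler_pdivrMr ?ltr0n//.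
by rewrite -natrM ler_nat.
Qed.

Lemma density_le (R : realType) n (C : set (lattice n.+1)) (K D N : nat) :
  (0 < D)%N ->
  (forall m, (N <= m)%N ->
    #|` fset_set (C `&` cube n.+1 m)| * D <= K * #|` fset_set (cube n.+1 m)|)%N ->
  (density R C <= (K%:R / D%:R)%:E)%E.
Proof.
move=> D0 le_cube; apply: (@limn_esup_le_eventually _ _ _ N) => m /le_cube.
rewrite lee_fin card_cube => le_card.
rewrite ler_pdivrMr ?ltr0n ?expn_gt0// mulrAC ler_pdivlMr ?ltr0n//.
by rewrite -!natrM ler_nat.
Qed.

Lemma identifying_density_ge (R : realType) n r (C : set (lattice n.+1)) :
  (0 < r)%N -> identifying r C ->
  (((2 ^ n.+2 * 3 ^ n * r ^ n)%N%:R^-1)%:E <= density R C)%E.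
Proof.
move=> r0 idC; have D0 : (0 < 2 ^ n.+2 * 3 ^ n * r ^ n)%N.
  by rewrite 2!muln_gt0 !expn_gt0 r0.
(* From this threshold on, shrinking the radius by [r.+1] at most halves the side of the cube, which
   costs [2 ^ n.+1]; the factor [3 ^ n] comes from [r.*2.+1 <= 3 * r]. *)
apply: (density_ge R (N := r.*2.+2) D0).
move=> M rM; have ME : M = (M - r.+1 + r.+1)%N by lia.
have := identifying_card_cube (M - r.+1) idC; rewrite -ME card_cube.
set a := #|` _|; set m := (M - r.+1)%N => le_m.
have le_M : (M.*2.+1 ^ n.+1 <= 2 ^ n.+1 * m.*2.+1 ^ n.+1)%N.
  by rewrite -expnMn leq_exp2r//; lia.
have le_r : (r.*2.+1 ^ n <= 3 ^ n * r ^ n)%N.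
  by rewrite -expnMn; case: (n) => // n'; rewrite leq_exp2r//; lia.
apply: (leq_trans le_M); rewrite (expnS 2 n.+1).
rewrite (_ : a * _ = 2 ^ n.+1 * (a * (2 * (3 ^ n * r ^ n))))%N; last first.
  by move: (2 ^ n.+1)%N (3 ^ n)%N (r ^ n)%N => x y z; lia.
rewrite leq_mul2l; apply/orP; right.
by rewrite (leq_trans le_m)// !leq_mul2l le_r !orbT.
Qed.

Lemma grid_lines_density_le (R : realType) n r :
  (n.+1 <= r)%N ->
  (density R (@grid_lines n.+1 (r %/ n.+1)) <=
   ((n.+1 * (4 * n.+1) ^ n)%N%:R / (r ^ n)%N%:R)%:E)%E.
Proof.
move=> nr; set k := (r %/ n.+1)%N.
have k0 : (0 < k)%N by rewrite divn_gt0.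
(* Since [k] is positive, [r < k.+1 * n.+1] and [k.+1 <= 2 * k]. *)
have rk : (r <= 2 * n.+1 * k)%N.
  by have := ltn_ceil r (ltn0Sn n); rewrite -/k; nia.
apply: (@density_le _ _ _ _ _ k); first by rewrite expn_gt0; lia.
move=> m km; rewrite card_cube.
(* With [q = m %/ k] and [k <= m], [q.*2.+1 * k] is at most [m.*2 + k], hence at most twice
   [m.*2.+1]. *)
have le_q : ((m %/ k).*2.+1 * r <= 4 * n.+1 * m.*2.+1)%N.
  have qk := leq_trunc_div m k; move: (m %/ k)%N qk => q qk.
  apply: (@leq_trans (q.*2.+1 * (2 * n.+1 * k))); first by rewrite leq_mul2l rk orbT.
  rewrite (_ : q.*2.+1 * _ = 2 * n.+1 * (q.*2.+1 * k))%N; last by lia.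
  rewrite (_ : 4 * _ * _ = 2 * n.+1 * (2 * m.*2.+1))%N; last by lia.
  by rewrite leq_mul2l; apply/orP; right; nia.
have le_qn : ((m %/ k).*2.+1 ^ n * r ^ n <= (4 * n.+1) ^ n * m.*2.+1 ^ n)%N.
  by rewrite -!expnMn; case: (n) le_q => // n' le_q; rewrite leq_exp2r.
apply: (leq_trans (leq_mul (card_grid_lines_cube n m k0) (leqnn _))).
rewrite -!mulnA leq_mul2l expnS [leqRHS]mulnCA; apply/orP; right.
by rewrite leq_mul2l le_qn orbT.
Qed.

Theorem theorem3 (R : realType) (n : nat) (hn : (1 <= n)%N) :
  exists (c1 c2 : R) (r0 : nat),
    [/\ 0 < c1, 0 < c2 &
      forall r : nat, (0 < r)%N -> (r0 <= r)%N ->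
        ((c1 / r%:R ^+ n.-1)%:E <= min_density R n r)%E /\
        (min_density R n r <= (c2 / r%:R ^+ n.-1)%:E)%E].
Proof.
case: n hn => // n _.
(* Here [n.+1] is the dimension; [r] must reach it for the mesh [r %/ n.+1] to be positive. *)
exists (2 ^ n.+2 * 3 ^ n)%N%:R^-1, (n.+1 * (4 * n.+1) ^ n)%N%:R, n.+1; split.
- by rewrite invr_gt0 ltr0n muln_gt0 !expn_gt0.
- by rewrite ltr0n muln_gt0 expn_gt0.
move=> r r0 nr; rewrite /= -natrX; split.
  apply: le_ereal_inf_tmp => _ [C idC <-].
  by rewrite -invfM -natrM identifying_density_ge.
apply: ge_ereal_inf; exists (density R (@grid_lines n.+1 (r %/ n.+1))).
  exists (grid_lines (r %/ n.+1)) => //; apply: identifying_grid_lines => //.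
    by rewrite divn_gt0.
  by rewrite mulnC leq_trunc_div.
exact: grid_lines_density_le.
Qed.
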